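(* Let $\nu=\mu$ (self-transport), where $\mu$ satisfies the standing assumptions stated in the context. Assume that $\mu$ has a density bounded away from zero, i.e. $\mu\ge c\cdot\mathrm{Leb}|_{\operatorname{spt}\mu}$ holds for some constant $c>0$, and that $\operatorname{spt}\mu$ has $L$-Lipschitz boundary. Then there exists a constant $C_{c,L}>0$ depending only on $c,L$ such that, for every $\varepsilon>0$, $$\operatorname{dist}(\operatorname{spt}\pi_\varepsilon;\operatorname{spt}\pi_\star)\le C_{c,L}\min\big(\varepsilon^{\frac1{d+2}},\operatorname{diam}(\operatorname{spt}\mu)\big).$$
   Context: Work in $\mathbb R^d$, $d\in\mathbb N$, with Euclidean norm $\|\cdot\|$; $B(x,r)$ is the open ball of radius $r$ around $x$, $\operatorname{diam}(A)=\sup_{x,y\in A}\|x-y\|$, $\mathrm{Leb}$ is Lebesgue measure on $\mathbb R^d$, and $[t]_+=\max(t,0)$. Standing assumptions: $\mu$ is a Borel probability measure on $\mathbb R^d$, absolutely continuous with respect to $\mathrm{Leb}$, with $\operatorname{spt}\mu\subseteq B(0,1)$ and with the interior of $\operatorname{spt}\mu$ connected. Self-transport setting: $\nu=\mu$. Put $\mathbb P=\mu\otimes\nu$, so $\operatorname{spt}\mathbb P=\operatorname{spt}\mu\times\operatorname{spt}\nu$. ''$L$-Lipschitz boundary'' has its usual meaning: locally, up to a rigid motion, the boundary is the graph of an $L$-Lipschitz function with the set lying on one side of it. Quadratically regularized optimal transport: for $\varepsilon>0$, $\pi_\varepsilon$ is the unique minimizer, over couplings $\pi$ of $\mu$ and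 $\nu$, of $\int\frac12\|x-y\|^2\,d\pi+\frac{\varepsilon}{2}\big\|\frac{d\pi}{d\mathbb P}\big\|^2_{L^2(\mathbb P)}$. It has density $\frac{d\pi_\varepsilon}{d\mathbb P}(x,y)=\frac1\varepsilon\big[f_\varepsilon(x)+g_\varepsilon(y)-\frac12\|x-y\|^2\big]_+$, where the optimal dual potentials $f_\varepsilon,g_\varepsilon:\mathbb R^d\to\mathbb R$ are continuous and determined, up to constant shifts $(f_\varepsilon+a,g_\varepsilon-a)$, by $$\int\big[f_\varepsilon(x)+g_\varepsilon(y)-\tfrac12\|x-y\|^2\big]_+\,\mu(dx)=\varepsilon\ \ \forall y\in\mathbb R^d,\qquad \int\big[f_\varepsilon(x)+g_\varepsilon(y)-\tfrac12\|x-y\|^2\big]_+\,\nu(dy)=\varepsilon\ \ \forall x\in\mathbb R^d.$$ The support of $\pi_\varepsilon$ is $\operatorname{spt}\pi_\varepsilon:=\overline{\{(x,y)\in\operatorname{spt}\mathbb P: f_\varepsilon(x)+g_\varepsilon(y)>\frac12\|x-y\|^2\}}$. The unregularized optimal coupling $\pi_\star$ (the minimizer of $\int\frac12\|x-y\|^2\,d\pi$ over couplings of $\mu$ and $\nu=\mu$) has $\operatorname{spt}\pi_\star=\{(x,x):x\in\operatorname{spt}\mu\}$. For $A,B\subseteq\mathbb R^d\times\mathbb R^d$, the asymmetric Hausdorff distance is $\operatorname{dist}(A;B):=\sup_{a\in A}\inf_{b\in B}\|a-b\|$, with $\|\cdot\|$ the product (Euclidean) norm on $\mathbb R^d\times\mathbb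 R^d$.
   Formalization: The constant depends on c, L, the dimension and also on a radius r > 0 on which the L-Lipschitz boundary charts exist at every boundary point; with c and L alone the claim fails for thin rectangles [-1/2,1/2]×[-δ,δ] as δ→0. *)

(* Defs.v *)
From HB Require Import structures.
From mathcomp Require Import all_boot all_order all_algebra.
From mathcomp Require Import all_classical all_reals all_analysis.

Set Implicit Arguments.
Unset Strict Implicit.
Unset Printing Implicit Defensive.

Import Order.TTheory GRing.Theory Num.Theory.
Import numFieldNormedType.Exports.

Local Open Scope classical_set_scope.
Local Open Scope ring_scope.

(* R^n is 'rV[R]_n, with the topology of the library (the product topology) and
   the Borel sigma-algebra. The library norm on 'rV[R]_n is the sup norm, so the
   Euclidean norm is defined separately. *)
Section borel_matrix.
Context (R : realType) (m n : nat).

Definition borel_mx : set (set 'M[R]_(m, n)) := <<s open >>.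

Let borel_mx0 : borel_mx set0.
Proof. exact: sigma_algebra0. Qed.

Let borel_mxC A : borel_mx A -> borel_mx (~` A).
Proof. exact: sigma_algebraC. Qed.

Let borel_mx_bigcup (F : (set 'M[R]_(m, n))^nat) :
  (forall i, borel_mx (F i)) -> borel_mx (\bigcup_i F i).
Proof. exact: sigma_algebra_bigcup. Qed.

HB.instance Definition _ := @isMeasurable.Build
  (sigma_display (@open 'M[R]_(m, n))) 'M[R]_(m, n) borel_mx
  borel_mx0 borel_mxC borel_mx_bigcup.

End borel_matrix.

Section euclidean.
Context {R : realType}.

Definition enorm n (x : 'rV[R]_n) : R := Num.sqrt (\sum_i x ord0 i ^+ 2).

Definition enorm2 n (z : 'rV[R]_n * 'rV[R]_n) : R :=
  Num.sqrt (enorm z.1 ^+ 2 + enorm z.2 ^+ 2).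

Definition eball n (x : 'rV[R]_n) (r : R) : set 'rV[R]_n :=
  [set y | enorm (y - x) < r].

Definition diam n (A : set 'rV[R]_n) : \bar R :=
  ereal_sup [set (enorm (p.1 - p.2))%:E | p in A `*` A].

Definition asym_dist n (A B : set ('rV[R]_n * 'rV[R]_n)) : \bar R :=
  ereal_sup [set ereal_inf [set (enorm2 (a - b))%:E | b in B] | a in A].

(* Lebesgue measure of Borel sets of R^n, as the iterated product of the
   one-dimensional one (row_mx t%:M v is the vector (t, v_1, ..., v_m)). *)
Fixpoint lebesgue_rV n : set 'rV[R]_n -> \bar R :=
  match n with
  | 0 => fun A => (\1_A 0)%:E
  | m.+1 => fun A =>
    (\int[@lebesgue_measure R]_t
       lebesgue_rV [set v : 'rV[R]_m | A (row_mx t%:M v)])%E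
  end.

Definition frontier (T : topologicalType) (A : set T) : set T :=
  closure A `\` A°.

(* In the coordinates y = x Q + b (a rigid motion, possibly with a reflection)
   the set A lies, near x0, on and above the graph y_d = gamma (y_1, ...,
   y_(d-1)). The radius r of these charts is the same at all boundary points
   and, with L, is part of the quantitative data of a Lipschitz boundary. For
   bounded A the existence of some such r > 0 is equivalent to the existence of
   charts of radius depending on x0 (by compactness of the boundary). *)
Definition lipschitz_boundary n (L r : R) (A : set 'rV[R]_n.+1) : Prop :=
  forall x0, frontier A x0 ->
  exists (Q : 'M[R]_n.+1) (b : 'rV[R]_n.+1) (gamma : 'rV[R]_n -> R),
    [/\ Q *m Q^T = 1%:M,
        forall u v, `|gamma u - gamma v| <= L * enorm (u - v)
      & forall x, eball x0 r x ->
          let y := x *m Q + b in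
          (A x <-> gamma (col' ord_max y) <= y ord0 ord_max) /\
          (frontier A x <-> gamma (col' ord_max y) = y ord0 ord_max)].

End euclidean.

Definition spt (R : realType) (T : topologicalType) (mu : set T -> \bar R) :
    set T :=
  [set x | forall U : set T, open U -> U x -> (0 < mu U)%E].

Section measures.
Context {R : realType} {n : nat}.
Local Notation Rn := 'rV[R]_n.
Implicit Types mu nu : probability Rn R.

Definition abs_continuous mu : Prop :=
  forall A : set Rn, measurable A -> lebesgue_rV A = 0%E -> mu A = 0%E.

Definition density_ge (c : R) mu : Prop :=
  forall A : set Rn, measurable A ->
    (c%:E * lebesgue_rV (A `&` spt mu) <= mu A)%E.

Definition standing_assumptions mu : Prop :=
  [/\ abs_continuous mu, spt mu `<=` eball 0 1 & connected (spt mu)°].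

Definition qcost (x y : Rn) : R := 2^-1 * enorm (x - y) ^+ 2.

Definition coupling mu nu (pi : probability (Rn * Rn)%type R) : Prop :=
  (forall A : set Rn, measurable A -> pi (A `*` setT) = mu A) /\
  (forall B : set Rn, measurable B -> pi (setT `*` B) = nu B).

Definition ot_cost (pi : probability (Rn * Rn)%type R) : \bar R :=
  (\int[pi]_z (qcost z.1 z.2)%:E)%E.

Definition ot_plan mu nu (pi : probability (Rn * Rn)%type R) : Prop :=
  coupling mu nu pi /\
  forall pi', coupling mu nu pi' -> (ot_cost pi <= ot_cost pi')%E.

Definition is_density mu nu (pi : probability (Rn * Rn)%type R)
    (p : Rn * Rn -> R) : Prop :=
  [/\ measurable_fun setT p, forall z, 0 <= p z
    & forall A, measurable A -> pi A = (\int[mu \x nu]_(z in A) (p z)%:E)%E].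

(* The squared L^2(mu (x) nu) norm of the density of pi; it is +oo when pi has
   no density (two densities agree a.e. and give the same value). *)
Definition density_sqnorm mu nu (pi : probability (Rn * Rn)%type R) : \bar R :=
  ereal_inf [set (\int[mu \x nu]_z (p z ^+ 2)%:E)%E | p in is_density mu nu pi].

Definition qot_cost (eps : R) mu nu (pi : probability (Rn * Rn)%type R) :
    \bar R :=
  (ot_cost pi + (eps / 2)%:E * density_sqnorm mu nu pi)%E.

Definition qot_plan (eps : R) mu nu (pi : probability (Rn * Rn)%type R) :
    Prop :=
  coupling mu nu pi /\
  forall pi', coupling mu nu pi' ->
    (qot_cost eps mu nu pi <= qot_cost eps mu nu pi')%E.

Definition qot_gap (f g : Rn -> R) (x y : Rn) : R := f x + g y - qcost x y.

Definition qot_potentials (eps : R) mu nu (f g : Rn -> R) : Prop :=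
  [/\ continuous f, continuous g,
      forall y, (\int[mu]_x (Num.max (qot_gap f g x y) 0)%:E)%E = eps%:E
    & forall x, (\int[nu]_y (Num.max (qot_gap f g x y) 0)%:E)%E = eps%:E].

(* The optimal plan together with its dual potentials. *)
Definition qot_solution (eps : R) mu nu (pi : probability (Rn * Rn)%type R)
    (f g : Rn -> R) : Prop :=
  [/\ qot_plan eps mu nu pi, qot_potentials eps mu nu f g
    & is_density mu nu pi
        (fun z => eps^-1 * Num.max (qot_gap f g z.1 z.2) 0)].

(* The support of the regularized plan, through its potentials. *)
Definition spt_qot mu nu (f g : Rn -> R) : set (Rn * Rn) :=
  closure [set z | spt (mu \x nu)%E z /\ 0 < qot_gap f g z.1 z.2].

End measures.

(* Main.v *)
Require Import Defs.
From HB Require Import structures.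
From mathcomp Require Import all_boot all_order all_algebra.
From mathcomp Require Import all_classical all_reals all_analysis.
From mathcomp Require Import measurable_realfun.
From mathcomp Require Import ring lra.

Set Implicit Arguments.
Unset Strict Implicit.
Unset Printing Implicit Defensive.

Import Order.TTheory GRing.Theory Num.Theory.
Import numFieldNormedType.Exports.

Local Open Scope classical_set_scope.
Local Open Scope ring_scope.

(** Write S for the support of mu, G(x, y) = f(x) + g(y) - |x - y|^2 / 2 for the
    gap of the potentials, and delta for the supremum of |x - y| over the pairs
    of S x S with G(x, y) > 0. The theorem reduces to delta^(d+2) <= eps / K
    with K depending on c, L, r and the dimension d = n + 1: the diagonal of S
    is contained in the support of the unregularized plan
    (diagonal_in_spt_ot_plan), so a pair (x, y) is at distance at most |x - y|
    from it, and the bound by the diameter is immediate.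

    The pair (x, y) is chosen with G(x, y) > 0 and |x - y| > delta / 2. Because
    both marginals are mu, the pairs with positive gap form a symmetric set
    (support_symmetric), so G(y, x) > 0 as well. The identity
      G(x, x) + G(y, y) = G(x, y) + G(y, x) + |x - y|^2
    (qot_gap_diag) then yields a point z of {x, y} with
    G(z, z) > delta^2 / 8.

    This positivity has to be propagated to a ball of radius proportional to
    delta, not delta^2, and a plain Lipschitz bound on g would be too weak. The
    definition of delta does better: all sections of the support have radius at
    most delta, so the equation satisfied by g shows that
      g(z) - g(w) <= delta |z - w| + |z - w|^2 / 2   for w in S
    (potential_almost_lipschitz). Hence G(z, w) >= delta^2 / 32 for w in S with
    |w - z| <= delta / 16.

    Finally S is thick near z: a Lipschitz domain contains, in each ball of
    small radius rho around one of its points, a ball of radius proportional to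
    rho
    (lipschitz_boundary_ball), of mass at least a constant times rho^d
    (mass_near_support_point). Integrating the positive part of G(z, .) gives
    eps >= K delta^2 delta^d (support_displacement). *)

(** * Euclidean norm *)

Section euclidean_norm.
Context {R : realType} {n : nat}.
Implicit Types u v x y : 'rV[R]_n.

Definition dotp u v : R := \sum_i u ord0 i * v ord0 i.

Lemma enorm_ge0 u : 0 <= enorm u.
Proof. exact: sqrtr_ge0. Qed.

Lemma enorm_sqr u : enorm u ^+ 2 = dotp u u.
Proof.
rewrite sqr_sqrtr; last by apply: sumr_ge0 => i _; exact: sqr_ge0.
by apply: eq_bigr => i _; rewrite expr2.
Qed.

Lemma enormD_sqr u v :
  enorm (u + v) ^+ 2 = enorm u ^+ 2 + 2 * dotp u v + enorm v ^+ 2.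
Proof.
rewrite !enorm_sqr /dotp mulr_sumr -!big_split /=.
by apply: eq_bigr => i _; rewrite !mxE; ring.
Qed.

Lemma enormZ t u : enorm (t *: u) = `|t| * enorm u.
Proof.
apply/eqP; rewrite -(@eqrXn2 _ 2) ?mulr_ge0 ?enorm_ge0 //; apply/eqP.
rewrite exprMn !enorm_sqr real_normK ?num_real // /dotp mulr_sumr.
by apply: eq_bigr => i _; rewrite !mxE; ring.
Qed.

Lemma enormN u : enorm (- u) = enorm u.
Proof. by rewrite -scaleN1r enormZ normrN1 mul1r. Qed.

Lemma enormB u v : enorm (u - v) = enorm (v - u).
Proof. by rewrite -enormN opprB. Qed.

Lemma enorm0 : enorm (0 : 'rV[R]_n) = 0.
Proof. by rewrite -(scale0r (0 : 'rV[R]_n)) enormZ normr0 mul0r. Qed.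

(** Cauchy-Schwarz: the polynomial t |-> |u + t v|^2 is nonnegative. *)
Lemma dotp_le_enorm u v : dotp u v <= enorm u * enorm v.
Proof.
have quad t : 0 <= enorm u ^+ 2 + 2 * t * dotp u v + t ^+ 2 * enorm v ^+ 2.
  rewrite -(real_normK (num_real t)) -exprMn -enormZ.
  suff -> : 2 * t * dotp u v = 2 * dotp u (t *: v).
    by rewrite -enormD_sqr sqr_ge0.
  rewrite /dotp -mulrA mulr_sumr; congr (2 * _).
  by apply: eq_bigr => i _; rewrite !mxE; ring.
have a0 := enorm_ge0 u; have b0 := enorm_ge0 v.
move: (enorm u) (enorm v) (dotp u v) quad a0 b0 => a b p quad a0 b0.
(* If |v| = 0 the polynomial is affine in t; a nonzero slope would make it
   negative at the t chosen below. *)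
have [b_eq0|b_neq0] := eqVneq b 0.
  rewrite b_eq0 mulr0; have := quad (- (a ^+ 2 + 1) / (2 * p)).
  rewrite b_eq0 expr0n mulr0 addr0 leNgt; apply: contraNT; rewrite -ltNge => p0.
  have -> : 2 * (- (a ^+ 2 + 1) / (2 * p)) * p = - (a ^+ 2 + 1).
    by field; rewrite gt_eqF.
  by lra.
have b2 : 0 < b ^+ 2 by rewrite exprn_gt0 // lt_neqAle eq_sym b_neq0.
(* t = - p / b^2 is the vertex of the parabola. *)
have := quad (- p / b ^+ 2).
have -> : a ^+ 2 + 2 * (- p / b ^+ 2) * p + (- p / b ^+ 2) ^+ 2 * b ^+ 2 =
    ((a * b) ^+ 2 - p ^+ 2) / b ^+ 2 by field.
rewrite pmulr_lge0 ?invr_gt0 // subr_ge0 => h.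
have [p0|p0] := lerP 0 p; first by rewrite -ler_sqr ?nnegrE ?mulr_ge0.
by apply: le_trans (ltW p0) _; exact: mulr_ge0.
Qed.

Lemma ler_enormD u v : enorm (u + v) <= enorm u + enorm v.
Proof.
rewrite -ler_sqr ?nnegrE ?addr_ge0 ?enorm_ge0 // enormD_sqr sqrrD.
have := dotp_le_enorm u v; lra.
Qed.

Lemma enorm_coord u i : `|u ord0 i| <= enorm u.
Proof.
rewrite -ler_sqr ?nnegrE ?enorm_ge0 // real_normK ?num_real //.
rewrite enorm_sqr /dotp (bigD1 i) //= -expr2 lerDl.
by apply: sumr_ge0 => j _; rewrite -expr2 sqr_ge0.
Qed.

Lemma continuous_enorm : continuous (@enorm R n).
Proof.
move=> x; apply: (@continuous_comp _ _ _ (fun x : 'rV[R]_n => \sum_i x ord0 i ^+ 2)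
  (@Num.sqrt R)); last exact: sqrt_continuous.
apply: (@continuous_big R 'I_n +%R 0 xpredT add_continuous) => i _ {}x.
by apply: (@continuous_comp _ _ _ (fun x : 'rV[R]_n => x ord0 i) (fun t : R => t ^+ 2));
  [exact: coord_continuous|exact: exprn_continuous].
Qed.
End euclidean_norm.

Lemma enorm_lt_coord (R : realType) n (u : 'rV[R]_n.+1) (s : R) :
  (forall i, `|u ord0 i| < s / n.+1%:R) -> enorm u < s.
Proof.
move=> us.
have n0 : (0 : R) < n.+1%:R by rewrite ltr0n.
have s0 : 0 < s.
  by have := le_lt_trans (normr_ge0 _) (us ord0); rewrite pmulr_lgt0 ?invr_gt0.
rewrite -ltr_sqr ?nnegrE ?enorm_ge0 ?ltW // enorm_sqr /dotp.
apply: (@lt_le_trans _ _ (\sum_(i < n.+1) (s / n.+1%:R) ^+ 2)).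
  apply: ltr_sum => [|i _].
    by apply/hasP; exists ord0 => //; rewrite mem_index_enum.
  rewrite -expr2 -(real_normK (num_real (u _ _))) ltr_sqr ?nnegrE // ltW //.
  by rewrite (le_lt_trans _ (us i)).
rewrite sumr_const card_ord -[leLHS]mulr_natl.
have -> : n.+1%:R * (s / n.+1%:R) ^+ 2 = s ^+ 2 / n.+1%:R :> R.
  by field; rewrite gt_eqF.
by rewrite ler_pdivrMr // ler_peMr ?sqr_ge0 // ler1n.
Qed.

(** * Borel sets, rational balls and supports *)

Section borel.
Context {R : realType}.

Definition rat_ball n (q : 'rV[rat]_n * nat) : set 'rV[R]_n :=
  ball (map_mx ratr q.1 : 'rV[R]_n) (q.2.+1%:R^-1).

Lemma rat_ball_open n (q : 'rV[rat]_n * nat) : open (rat_ball q).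
Proof. exact: ball_open. Qed.

Lemma ball_rVP n (x y : 'rV[R]_n) (e : R) : 0 < e ->
  ball x e y <-> forall i, `|x ord0 i - y ord0 i| < e.
Proof.
move=> e0; split; first by move=> [_ +] i => /(_ ord0 i).
move=> h; split => // i j; rewrite (ord1 i); exact: h.
Qed.

(** The countably many balls with rational centre and radius 1/(k+1) form a
    base of the topology. This is what makes open subsets of the product
    measurable for the product sigma-algebra, and the complement of the support
    of a measure a null set. *)
Lemma rat_ball_basis n (U : set 'rV[R]_n) x : open U -> U x ->
  exists q, rat_ball q x /\ rat_ball q `<=` U.
Proof.
move=> oU Ux; have /nbhs_ballP[e /= e0 eU] : nbhs x U by exact: open_nbhs_nbhs.
have [k ke] : exists k, k.+1%:R^-1 < e / 2.
  have e2 : 0 < e / 2 by rewrite divr_gt0.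
  have [k _ /(_ k (leqnn k))] := near_infty_natSinv_lt (PosNum e2).
  by exists k.
have k0 : 0 < k.+1%:R^-1 :> R by rewrite invr_gt0 ltr0n.
have /fin_all_exists[q qx] : forall i : 'I_n, exists q : rat,
    `|ratr q - x ord0 i| < k.+1%:R^-1.
  move=> i; have [|q] :=
    @rat_in_itvoo _ (x ord0 i - k.+1%:R^-1) (x ord0 i + k.+1%:R^-1).
    by rewrite ltrD2l (lt_trans _ k0) // oppr_lt0.
  by rewrite in_itv /= -ltr_distlC distrC; exists q.
exists (\row_i q i, k); split.
  by apply/ball_rVP => // i; rewrite !mxE.
move=> y /ball_rVP => /(_ k0) yq; apply: eU; apply/ball_rVP => // i.
have := yq i; have := qx i; rewrite !mxE.
have -> : x ord0 i - y ord0 i =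
  (ratr (q i) - y ord0 i) - (ratr (q i) - x ord0 i) by ring.
move=> h1 h2; apply: (le_lt_trans (ler_normB _ _)).
by have := ltrD (lt_trans h2 ke) (lt_trans h1 ke); rewrite -splitr.
Qed.

Lemma open_measurable_rV n (U : set 'rV[R]_n) : open U -> measurable U.
Proof. by move=> oU; exact: sub_sigma_algebra. Qed.

Lemma continuous_measurable_rV n (f : 'rV[R]_n -> R) :
  continuous f -> measurable_fun setT f.
Proof.
move=> cf; apply: (measurability _ (@RGenOpens.measurableE R)) => //.
move=> _ [_ [x [y ->]] <-]; rewrite setTI; apply: open_measurable_rV.
by apply: open_comp => // z _; exact: cf.
Qed.

Lemma open_prod_basis n (U : set ('rV[R]_n * 'rV[R]_n)) z : open U -> U z ->
  exists p : ('rV[rat]_n * nat) * ('rV[rat]_n * nat),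
    [/\ rat_ball p.1 z.1, rat_ball p.2 z.2
      & rat_ball p.1 `*` rat_ball p.2 `<=` U].
Proof.
move=> oU Uz; have : nbhs z U by exact: open_nbhs_nbhs.
move=> [[A B] [/= nA nB] ABU].
have [q1 [h1 q1A]] := rat_ball_basis (open_interior A) nA.
have [q2 [h2 q2B]] := rat_ball_basis (open_interior B) nB.
exists (q1, q2); split => //= y [/q1A /interior_subset ? /q2B /interior_subset ?].
exact: ABU.
Qed.

Lemma open_measurable_prod n (U : set ('rV[R]_n * 'rV[R]_n)) :
  open U -> measurable U.
Proof.
move=> oU.
pose F (p : ('rV[rat]_n * nat) * ('rV[rat]_n * nat)) :
    set ('rV[R]_n * 'rV[R]_n) :=
  if pselect (rat_ball p.1 `*` rat_ball p.2 `<=` U) is left _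
  then rat_ball p.1 `*` rat_ball p.2 else set0.
have -> : U = \bigcup_p F p.
  apply/seteqP; split => z.
    move=> /(open_prod_basis oU)[p [? ? pU]]; exists p => //.
    by rewrite /F; case: pselect.
  by move=> [p _]; rewrite /F; case: pselect => // pU; exact: pU.
apply: countable_bigcupT_measurable => // p; rewrite /F; case: pselect => // _.
by apply: measurableX; apply: open_measurable_rV; exact: rat_ball_open.
Qed.

Lemma spt_closed (T : topologicalType) (m : set T -> \bar R) : closed (spt m).
Proof.
rewrite -openC openE => x /= /existsNP[U] /not_implyP[oU] /not_implyP[Ux mU].
by rewrite /interior nbhsE; exists U => // y Uy /(_ U oU Uy)/mU.
Qed.

(** Every point outside the support lies in a null basic ball, and there are
    only countably many of these. *)
Lemma measure_sptC n (mu : probability 'rV[R]_n R) : mu (~` spt mu) = 0%E.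
Proof.
have mS : measurable (~` spt mu).
  by apply: open_measurable_rV; rewrite openC; exact: spt_closed.
pose F (k : nat) : set 'rV[R]_n := if unpickle k is Some q then
  if mu (rat_ball q) == 0%E then rat_ball q else set0 else set0.
apply/negligibleP => //.
apply: (@negligibleS _ _ _ _ (\bigcup_k F k)).
  move=> x /existsNP[U] /not_implyP[oU] /not_implyP[Ux mU].
  have [q [qx qU]] := rat_ball_basis oU Ux.
  exists (pickle q) => //; rewrite /F pickleK.
  case: ifPn => //; rewrite -measure_le0 -ltNge => h; exfalso; apply: mU.
  apply: (lt_le_trans h).
  apply: le_measure => //; rewrite inE; apply: open_measurable_rV => //.
  exact: rat_ball_open.
apply: negligible_bigcup => k; rewrite /F.
case: unpickle => [q|]; last exact: negligible_set0.
case: ifPn => [/eqP q0|_]; last exact: negligible_set0.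
by apply/negligibleP => //; apply: open_measurable_rV; exact: rat_ball_open.
Qed.
End borel.

Lemma spt_product_coords (R : realType) n (mu : probability 'rV[R]_n R) z :
  spt (mu \x mu)%E z -> spt mu z.1 /\ spt mu z.2.
Proof.
move=> Sz; have muT : (mu setT = 1)%E := probability_setT mu.
split => U oU Uz.
  have <- : (mu \x mu)%E (fst @^-1` U) = mu U.
    have -> : fst @^-1` U = U `*` setT :> set ('rV[R]_n * 'rV[R]_n).
      by apply/seteqP; split => y //; case.
    rewrite product_measure1E //; last exact: open_measurable_rV.
    by rewrite [X in (_ * X)%E]muT mule1.
  by apply: Sz => //; apply: open_comp => // y _; exact: cvg_fst.
have <- : (mu \x mu)%E (snd @^-1` U) = mu U.
  have -> : snd @^-1` U = setT `*` U :> set ('rV[R]_n * 'rV[R]_n).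
    by apply/seteqP; split => y //; case.
  rewrite product_measure1E //; last exact: open_measurable_rV.
  by rewrite [X in (X * _)%E]muT mul1e.
by apply: Sz => //; apply: open_comp => // y _; exact: cvg_snd.
Qed.


(** * Strict inequalities between functions with equal integrals *)

Section equal_integrals.
Context d (T : measurableType d) (R : realType).
Variables (mu : {measure set T -> \bar R}) (D : set T).
Hypothesis mD : measurable D.

(** The nonnegative function h2 - h1 has zero integral, hence vanishes almost
    everywhere. Both structural facts about the potentials (symmetry of the
    support and almost-Lipschitz bound) are contradictions of this kind: two
    integrals are known to coincide, while a strict inequality would hold on a
    set of positive measure. *)
Lemma integral_eq_null_lt (h1 h2 : T -> R) (A : set T) :
  measurable_fun D h1 -> measurable_fun D h2 ->
  (forall x, D x -> 0 <= h1 x <= h2 x) ->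
  (\int[mu]_(x in D) (h1 x)%:E < +oo)%E ->
  (\int[mu]_(x in D) (h2 x)%:E <= \int[mu]_(x in D) (h1 x)%:E)%E ->
  measurable A -> A `<=` D -> (forall x, A x -> h1 x < h2 x) -> mu A = 0%E.
Proof.
move=> m1 m2 h12 fin le21 mA AD strict.
have m12 : measurable_fun D (EFin \o (h2 \- h1)).
  by apply/measurable_EFinP; exact: measurable_funB.
have split21 : (\int[mu]_(x in D) (h2 x)%:E =
    \int[mu]_(x in D) (h1 x)%:E + \int[mu]_(x in D) (h2 x - h1 x)%:E)%E.
  rewrite -ge0_integralD //=.
  - by apply: eq_integral => x _; rewrite -EFinD addrC subrK.
  - by move=> x /h12 /andP[? _]; rewrite lee_fin.
  - exact/measurable_EFinP.
  - by move=> x /h12 /andP[_ ?]; rewrite lee_fin subr_ge0.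
have diff0 : (\int[mu]_(x in D) `|(h2 x - h1 x)%:E| = 0)%E.
  have -> : (\int[mu]_(x in D) `|(h2 x - h1 x)%:E| =
      \int[mu]_(x in D) (h2 x - h1 x)%:E)%E.
    apply: eq_integral => x; rewrite inE => /h12 /andP[_ ?].
    by rewrite gee0_abs // lee_fin subr_ge0.
  have I1 : (\int[mu]_(x in D) (h1 x)%:E)%E \is a fin_num.
    by rewrite ge0_fin_numE // integral_ge0 // => x /h12 /andP[? _]; rewrite lee_fin.
  have I12 : (0 <= \int[mu]_(x in D) (h2 x - h1 x)%:E)%E.
    by apply: integral_ge0 => x /h12 /andP[_ ?]; rewrite lee_fin subr_ge0.
  apply/eqP; rewrite eq_le I12 andbT.
  by move: le21; rewrite split21 -[leRHS]adde0 leeD2lE.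
have /ae_eq_integral_abs -/(_ mD m12) [N [mN N0 sub]] := diff0.
apply/negligibleP => //; exists N; split => // x Ax; apply: sub => /= /(_ (AD _ Ax)) [].
by move=> /eqP; rewrite subr_eq0 gt_eqF // strict.
Qed.

End equal_integrals.

(** * The gap and the potentials *)

Section gap.
Context {R : realType} {n : nat}.
Local Notation Rn := 'rV[R]_n.
Implicit Types (f g : Rn -> R) (mu nu : probability Rn R).

Lemma qcostC (x y : Rn) : qcost x y = qcost y x.
Proof. by rewrite /qcost enormB. Qed.

Lemma continuous_enorm_sub : continuous (fun z : Rn * Rn => enorm (z.1 - z.2)).
Proof.
move=> z.
apply: (@continuous_comp _ _ _ (fun z : Rn * Rn => z.1 - z.2) (@enorm R n));
  last exact: continuous_enorm.
by apply: cvgB; [exact: cvg_fst|exact: cvg_snd].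
Qed.

Lemma continuous_qcost : continuous (fun z : Rn * Rn => qcost z.1 z.2).
Proof.
move=> z; apply: cvgM; first exact: cvg_cst.
apply: (@continuous_comp _ _ _ (fun z : Rn * Rn => enorm (z.1 - z.2)) (fun t : R => t ^+ 2));
  last exact: exprn_continuous.
exact: continuous_enorm_sub.
Qed.

Lemma continuous_qot_gap f g : continuous f -> continuous g ->
  continuous (fun z : Rn * Rn => qot_gap f g z.1 z.2).
Proof.
move=> cf cg z; apply: cvgB; last exact: continuous_qcost.
apply: cvgD.
  by apply: (@continuous_comp _ _ _ fst f); [exact: cvg_fst|exact: cf].
by apply: (@continuous_comp _ _ _ snd g); [exact: cvg_snd|exact: cg].
Qed.

Lemma continuous_measurable_prod (h : Rn * Rn -> R) :
  continuous h -> measurable_fun setT h.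
Proof.
move=> ch; apply: (measurability _ (@RGenOpens.measurableE R)) => //.
move=> _ [_ [x [y ->]] <-]; rewrite setTI; apply: open_measurable_prod.
by apply: open_comp => // z _; exact: ch.
Qed.

Definition gap_pos f g (z : Rn * Rn) : R := Num.max (qot_gap f g z.1 z.2) 0.

Lemma measurable_gap_pos f g : continuous f -> continuous g ->
  measurable_fun setT (gap_pos f g).
Proof.
move=> cf cg; apply: (@measurable_maxr _ _ _ setT _ (cst 0)) => //.
by apply: continuous_measurable_prod; exact: continuous_qot_gap.
Qed.

Lemma qot_gap_swap f g x y : qot_gap g f y x = qot_gap f g x y.
Proof. by rewrite /qot_gap qcostC [g y + _]addrC. Qed.

Lemma qot_gap_asym f g x y :
  qot_gap f g x y - qot_gap f g y x = (f x - g x) - (f y - g y).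
Proof. by rewrite /qot_gap (qcostC y x); ring. Qed.

Lemma qot_gap_diag f g x y :
  qot_gap f g x x + qot_gap f g y y =
  qot_gap f g x y + qot_gap f g y x + enorm (x - y) ^+ 2.
Proof.
rewrite /qot_gap /qcost !subrr enorm0 (enormB y x) expr0n /= mulr0.
by field.
Qed.

Lemma qcost_shift (x y y' : Rn) :
  qcost x y' <= qcost x y + enorm (x - y) * enorm (y' - y) + enorm (y' - y) ^+ 2 / 2.
Proof.
have -> : qcost x y' = qcost x y + dotp (x - y) (y - y') + enorm (y' - y) ^+ 2 / 2.
  rewrite /qcost (_ : x - y' = (x - y) + (y - y')); last by rewrite addrA subrK.
  by rewrite enormD_sqr (enormB y' y); field.
have := dotp_le_enorm (x - y) (y - y'); rewrite (enormB y y'); lra.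
Qed.

(** Call section of y the set of points x of the support with positive gap.
    Moving y to y' raises the cost by at most delta |y' - y| + |y' - y|^2 / 2
    at every x of this section, because the section lies in the ball of
    radius delta around y. If g grew by more than that, the positive part of
    the gap would increase at every point of the section, and its integral
    could not stay equal to eps. The points y and y' are compared directly, not
    along a path in the support. *)
Lemma potential_almost_lipschitz f g mu (eps delta : R) : 0 < eps ->
  continuous f -> continuous g ->
  (forall y, (\int[mu]_x (Num.max (qot_gap f g x y) 0)%:E)%E = eps%:E) ->
  (forall x y, spt mu x -> spt mu y -> 0 < qot_gap f g x y ->
    enorm (x - y) <= delta) ->
  forall y y', spt mu y ->
  g y' <= g y + delta * enorm (y' - y) + enorm (y' - y) ^+ 2 / 2.
Proof.
move=> eps0 cf cg eqf hdelta y y' Sy; rewrite leNgt; apply/negP => lt_g.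
have mS : measurable (spt mu).
  by rewrite -[spt mu]setCK; apply: measurableC; apply: open_measurable_rV;
    rewrite openC; exact: spt_closed.
have mgap w : measurable_fun setT (fun x => Num.max (qot_gap f g x w) 0).
  exact: (measurableT_comp (measurable_gap_pos cf cg) (pair2_measurable w)).
have intS w :
    (\int[mu]_(x in spt mu) (Num.max (qot_gap f g x w) 0)%:E = eps%:E)%E.
  rewrite -(eqf w) [RHS](@ge0_negligible_integral _ _ _ _ _ (~` spt mu)) //.
  - by rewrite setTD setCK.
  - exact: measurableC.
  - exact/measurable_EFinP.
  - by move=> x _; rewrite lee_fin le_max lexx orbT.
  - exact: measure_sptC.
have pos_incr x : spt mu x -> 0 < qot_gap f g x y ->
    qot_gap f g x y < qot_gap f g x y'.
  move=> Sx gap0; rewrite /qot_gap.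
  have := qcost_shift x y y'.
  have := ler_wpM2r (enorm_ge0 (y' - y)) (hdelta x y Sx Sy gap0).
  lra.
pose h w x := Num.max (qot_gap f g x w) 0.
pose A := spt mu `&` h y @^-1` `]0, +oo[.
have mA : measurable A.
  apply: measurableI => //; rewrite -[X in measurable X]setTI.
  by apply: mgap => //; exact: measurable_itv.
have hA x : A x <-> spt mu x /\ 0 < qot_gap f g x y.
  by rewrite /A /h /= in_itv /= andbT lt_max ltxx orbF.
have A0 : mu A = 0%E.
  apply: (@integral_eq_null_lt _ _ _ mu (spt mu) mS (h y) (h y')) => //.
  - exact: (measurable_funTS (mgap y)).
  - exact: (measurable_funTS (mgap y')).
  - move=> x Sx; apply/andP; rewrite /h; split; first by rewrite le_max lexx orbT.
    rewrite ge_max [X in _ && X]le_max lexx orbT andbT.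
    have [/(pos_incr _ Sx) /ltW h1|h1] := ltP 0 (qot_gap f g x y).
      by rewrite le_max h1.
    by rewrite le_max h1 orbT.
  - by rewrite intS ltry.
  - by rewrite !intS.
  - by move=> x [].
  - move=> x /hA[Sx gap0]; rewrite /h.
    by rewrite (max_l (ltW gap0)) lt_max pos_incr.
have : (\int[mu]_(x in spt mu) (h y x)%:E = 0)%E.
  rewrite (@ge0_negligible_integral _ _ _ _ _ A) //; last 2 first.
  - by apply/measurable_EFinP; exact: (measurable_funTS (mgap y)).
  - by move=> x _; rewrite lee_fin le_max lexx orbT.
  apply: integral0_eq => x [Sx nA]; congr (_%:E); apply: max_r.
  by rewrite leNgt; apply/negP => gap0; apply: nA; apply/hA.
by rewrite intS => -[] /eqP; rewrite gt_eqF.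
Qed.

End gap.

(** * Symmetry of the support in the self-transport problem *)

Section weighted_marginals.
Context d (T : measurableType d) (R : realType) (mu : probability T R).
Variables (K : T * T -> R) (a : T -> R) (eps : R).
Hypotheses (mK : measurable_fun setT K) (K0 : forall z, 0 <= K z).
Hypotheses (ma : measurable_fun setT a) (a0 : forall x, 0 <= a x).

Lemma integral_weight_fst :
  (forall x, \int[mu]_y (K (x, y))%:E = eps%:E)%E ->
  (\int[mu \x mu]_z (K z * a z.1)%:E = eps%:E * \int[mu]_x (a x)%:E)%E.
Proof.
move=> margK.
have eps0 : 0 <= eps.
  by rewrite -lee_fin -(margK point); apply: integral_ge0 => y _; rewrite lee_fin.
rewrite fubini_tonelli1 /=; last 2 first.
- apply/measurable_EFinP; apply: measurable_funM => //.
  exact: measurableT_comp.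
- by move=> z; rewrite lee_fin mulr_ge0.
rewrite -ge0_integralZl //; last 2 first.
- exact/measurable_EFinP.
- by move=> x _; rewrite lee_fin.
apply: eq_integral => x _; rewrite /fubini_F /=.
under eq_integral do rewrite EFinM.
rewrite ge0_integralZr ?margK ?lee_fin //.
  apply/measurable_EFinP; exact: (measurableT_comp mK (pair1_measurable x)).
by move=> y _; rewrite lee_fin.
Qed.

Lemma integral_weight_snd :
  (forall y, \int[mu]_x (K (x, y))%:E = eps%:E)%E ->
  (\int[mu \x mu]_z (K z * a z.2)%:E = eps%:E * \int[mu]_x (a x)%:E)%E.
Proof.
move=> margK.
have eps0 : 0 <= eps.
  by rewrite -lee_fin -(margK point); apply: integral_ge0 => y _; rewrite lee_fin.
rewrite fubini_tonelli2 /=; last 2 first.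
- apply/measurable_EFinP; apply: measurable_funM => //.
  exact: measurableT_comp.
- by move=> z; rewrite lee_fin mulr_ge0.
rewrite -ge0_integralZl //; last 2 first.
- exact/measurable_EFinP.
- by move=> x _; rewrite lee_fin.
apply: eq_integral => y _; rewrite /fubini_G /=.
under eq_integral do rewrite EFinM.
rewrite ge0_integralZr ?margK ?lee_fin //.
  apply/measurable_EFinP; exact: (measurableT_comp mK (pair2_measurable y)).
by move=> x _; rewrite lee_fin.
Qed.
End weighted_marginals.

Section symmetry.
Context {R : realType} {n : nat}.
Local Notation Rn := 'rV[R]_n.
Variables (f g : Rn -> R) (mu : probability Rn R) (eps : R).
Hypothesis pot : qot_potentials eps mu mu f g.

Let cf : continuous f. Proof. by case: pot. Qed.
Let cg : continuous g. Proof. by case: pot. Qed.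

Let u (x : Rn) : R := f x - g x.
(* An increasing function of u which is positive and bounded: with this weight
   all integrals below are finite, however fast f and g grow. *)
Let a (x : Rn) : R := pi / 2 + atan (u x).
Let K (z : Rn * Rn) : R := gap_pos f g z.
Let Kt (z : Rn * Rn) : R := gap_pos f g (z.2, z.1).

Let cu : continuous u.
Proof. by move=> x; exact: (cvgB (@cf x) (@cg x)). Qed.

Let ma : measurable_fun setT a.
Proof.
apply: continuous_measurable_rV => x.
exact: (cvgD (cvg_cst _) (continuous_comp (@cu x) (@continuous_atan R (u x)))).
Qed.

Let a0 x : 0 <= a x.
Proof. by rewrite /a; have := atan_gtNpi2 (u x); lra. Qed.

Let a_le x : a x <= pi.
Proof. by rewrite /a; have := atan_ltpi2 (u x); lra. Qed.

Let K0 z : 0 <= K z. Proof. by rewrite /K le_max lexx orbT. Qed.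
Let Kt0 z : 0 <= Kt z. Proof. exact: K0. Qed.
Let mK : measurable_fun setT K. Proof. exact: (measurable_gap_pos (@cf) (@cg)). Qed.
Let mKt : measurable_fun setT Kt.
Proof.
apply: (measurableT_comp mK) => /=.
by apply: measurable_fun_pair; [exact: measurable_snd|exact: measurable_fst].
Qed.

Let a_fin : (\int[mu]_x (a x)%:E < +oo)%E.
Proof.
apply: (@le_lt_trans _ _ (\int[mu]_x (cst pi%:E x))%E).
  apply: ge0_le_integral => //.
  - by move=> x _; rewrite lee_fin.
  - exact/measurable_EFinP.
  - by move=> x _; rewrite lee_fin.
rewrite integral_cst //; have mu1 : (mu setT = 1)%E := probability_setT mu.
by rewrite [X in (_ * X)%E]mu1 mule1 ltry.
Qed.

(** Since both marginals are the same measure, the positive part K of the gap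
    and its transpose Kt have the same marginals. Hence K and Kt have the same
    integral against any weight a(x) and against any weight a(y), so
    (K - Kt)(a(x) - a(y)) has integral zero. As K - Kt has the sign of
    u(x) - u(y), where u = f - g, this integrand is nonnegative when a is an
    increasing function of u. It is therefore null almost everywhere, which
    forbids the gap to be positive near a point of the support of the product
    measure at which u(x) > u(y). *)
Lemma support_symmetric x0 y0 : spt mu x0 -> spt mu y0 ->
  0 < qot_gap f g x0 y0 -> 0 < qot_gap f g y0 x0.
Proof.
move=> Sx Sy gap0.
have [|lt_u] := lerP (u x0) (u y0).
  by have := qot_gap_asym f g x0 y0; rewrite /u; lra.
have [_ _ eqx eqy] := pot.
have mfst (h : Rn -> R) : measurable_fun setT h ->
    measurable_fun setT (fun z : Rn * Rn => h z.1).
  by move=> mh; apply: measurableT_comp mh _.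
have msnd (h : Rn -> R) : measurable_fun setT h ->
    measurable_fun setT (fun z : Rn * Rn => h z.2).
  by move=> mh; apply: measurableT_comp mh _.
pose h1 z := K z * a z.1 + Kt z * a z.2.
pose h2 z := Kt z * a z.1 + K z * a z.2.
have intD (P Q : Rn * Rn -> R) : measurable_fun setT P -> measurable_fun setT Q ->
    (forall z, 0 <= P z) -> (forall z, 0 <= Q z) ->
    (\int[mu \x mu]_z (P z + Q z)%:E =
     \int[mu \x mu]_z (P z)%:E + \int[mu \x mu]_z (Q z)%:E)%E.
  move=> mP mQ P0 Q0; rewrite -ge0_integralD //=.
  - by move=> z _; rewrite lee_fin.
  - exact/measurable_EFinP.
  - by move=> z _; rewrite lee_fin.
  - exact/measurable_EFinP.
have I1 : (\int[mu \x mu]_z (h1 z)%:E =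
    eps%:E * \int[mu]_x (a x)%:E + eps%:E * \int[mu]_x (a x)%:E)%E.
  rewrite /h1 intD; first last.
  - by move=> z; rewrite mulr_ge0.
  - by move=> z; rewrite mulr_ge0.
  - by apply: measurable_funM => //; exact: msnd.
  - by apply: measurable_funM => //; exact: mfst.
  rewrite (@integral_weight_fst _ _ _ mu K a eps) //.
  by rewrite (@integral_weight_snd _ _ _ mu Kt a eps).
have I2 : (\int[mu \x mu]_z (h2 z)%:E =
    eps%:E * \int[mu]_x (a x)%:E + eps%:E * \int[mu]_x (a x)%:E)%E.
  rewrite /h2 intD; first last.
  - by move=> z; rewrite mulr_ge0.
  - by move=> z; rewrite mulr_ge0.
  - by apply: measurable_funM => //; exact: msnd.
  - by apply: measurable_funM => //; exact: mfst.
  rewrite (@integral_weight_fst _ _ _ mu Kt a eps) //.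
  by rewrite (@integral_weight_snd _ _ _ mu K a eps).
have h12 z : h1 z - h2 z = (K z - Kt z) * (a z.1 - a z.2) by rewrite /h1 /h2; ring.
have Kle z : u z.2 <= u z.1 -> Kt z <= K z.
  have := qot_gap_asym f g z.1 z.2; rewrite /u /K /Kt /gap_pos /= => e le_u.
  by rewrite ge_max !le_max lexx !orbT andbT; apply/orP; left; lra.
have Kge z : u z.1 <= u z.2 -> K z <= Kt z.
  by case: z => x y; exact: (Kle (y, x)).
have a_mono x y : u x <= u y -> a x <= a y.
  rewrite le_eqVlt => /orP[/eqP xy|/lt_atan xy]; first by rewrite /a xy.
  by rewrite /a lerD2l ltW.
have le21 z : h2 z <= h1 z.
  rewrite -subr_ge0 h12; have [le_u|/ltW le_u] := lerP (u z.2) (u z.1).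
    by rewrite mulr_ge0 // subr_ge0; [exact: Kle|exact: a_mono].
  by rewrite mulr_le0 // subr_le0; [exact: Kge|exact: a_mono].
pose W : set (Rn * Rn) :=
  [set z | 0 < qot_gap f g z.1 z.2] `&` [set z | 0 < u z.1 - u z.2].
have oW : open W.
  apply: openI.
    apply: (@open_comp _ _ (fun z => qot_gap f g z.1 z.2) [set t | 0 < t]) => [z _|].
      exact: (continuous_qot_gap (@cf) (@cg)).
    exact: open_gt.
  apply: (@open_comp _ _ (fun z : Rn * Rn => u z.1 - u z.2) [set t | 0 < t]) => [z _|].
    apply: cvgB.
      by apply: (@continuous_comp _ _ _ fst u); [exact: cvg_fst|exact: (@cu z.1)].
    by apply: (@continuous_comp _ _ _ snd u); [exact: cvg_snd|exact: (@cu z.2)].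
  exact: open_gt.
have W0 : (mu \x mu)%E W = 0%E.
  apply: (@integral_eq_null_lt _ _ _ (mu \x mu)%E setT measurableT h2 h1) => //.
  - apply: measurable_funD; apply: measurable_funM => //; [exact: mfst|exact: msnd].
  - apply: measurable_funD; apply: measurable_funM => //; [exact: mfst|exact: msnd].
  - by move=> z _; rewrite le21 andbT addr_ge0 // mulr_ge0.
  - rewrite I2; have afin : (\int[mu]_x (a x)%:E)%E \is a fin_num.
      by rewrite ge0_fin_numE // integral_ge0 // => x _; rewrite lee_fin.
    by rewrite ltey_eq fin_numD !fin_numM.
  - by rewrite I1 I2.
  - exact: open_measurable_prod.
  move=> z [/= gap_z]; rewrite subr_gt0 => lt_uz.
  rewrite -subr_gt0 h12 mulr_gt0 // subr_gt0; last first.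
    by rewrite /a ltrD2l; exact: lt_atan.
  have := qot_gap_asym f g z.1 z.2; rewrite /K /Kt /gap_pos /= (max_l (ltW gap_z)).
  by move: lt_uz; rewrite /u gt_max gap_z andbT; lra.
have W_x0y0 : W (x0, y0) by split => //=; rewrite subr_gt0.
have [p [p1 p2 pW]] := open_prod_basis oW W_x0y0.
have m1 := open_measurable_rV (@rat_ball_open R n p.1).
have m2 := open_measurable_rV (@rat_ball_open R n p.2).
have : ((mu \x mu) (rat_ball p.1 `*` rat_ball p.2) <= (mu \x mu) W)%E.
  apply: le_measure => //; rewrite inE; first exact: measurableX.
  exact: open_measurable_prod.
rewrite W0 leNgt product_measure1E // => /negP[].
by apply: mule_gt0; [apply: Sx|apply: Sy] => //; exact: rat_ball_open.
Qed.
End symmetry.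

(** * Volume near the points of a Lipschitz domain *)

Section lebesgue_cube.
Context {R : realType}.

Lemma lebesgue_rV0 n : lebesgue_rV (set0 : set 'rV[R]_n) = 0%E.
Proof.
elim: n => [|n IH] /=; first by rewrite indicE in_set0.
by rewrite -[RHS](integral0 (@lebesgue_measure R) setT); apply: eq_integral => t _.
Qed.

(** Balls of row vectors are those of the sup norm: cubes, each of whose slices
    is empty or a cube of one dimension less. *)
Lemma lebesgue_rV_cube n (p : 'rV[R]_n) (s : R) : 0 < s ->
  lebesgue_rV (ball p s) = ((2 * s) ^+ n)%:E.
Proof.
move=> s0; elim: n p => [|n IH] p /=.
  by rewrite indicE mem_set // ball_rVP // => -[].
pose q : 'rV[R]_n := \row_i p ord0 (lift ord0 i).
have slice (t : R) : [set v : 'rV[R]_n | ball p s (row_mx t%:M v)] =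
    if t \in (ball (p ord0 ord0) s : set R) then ball q s else set0.
  have row0 (v : 'rV[R]_n) : (row_mx t%:M v : 'rV_n.+1) ord0 ord0 = t.
    rewrite -[RHS](_ : (row_mx t%:M v) ord0 (lshift n ord0) = t).
      by congr (fun_of_matrix _ _ _); exact: val_inj.
    by rewrite row_mxEl mxE eqxx.
  have rowS (v : 'rV[R]_n) i :
      (row_mx t%:M v : 'rV_n.+1) ord0 (lift ord0 i) = v ord0 i.
    rewrite -[RHS](row_mxEr (t%:M : 'M[R]_1) v ord0 i).
    by congr (fun_of_matrix _ _ _); exact: val_inj.
  apply/seteqP; split => v /=.
    move=> /ball_rVP - /(_ s0) h; rewrite mem_set; last first.
      by have := h ord0; rewrite row0.
    by apply/ball_rVP => // i; have := h (lift ord0 i); rewrite rowS !mxE.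
  case: ifPn => // /set_mem tp /ball_rVP - /(_ s0) vq.
  apply/ball_rVP => // i; case: (unliftP ord0 i) => [j|] ->; last by rewrite row0.
  by have := vq j; rewrite rowS !mxE.
under eq_integral => t _.
  rewrite slice (fun_if (@lebesgue_rV R n)) IH lebesgue_rV0.
  over.
rewrite [LHS](_ : _ = \int[lebesgue_measure]_t
    ((2 * s) ^+ n * \1_(ball (p ord0 ord0) s) t)%:E)%E; last first.
  apply: eq_integral => t _; rewrite indicE.
  by case: ifPn => _; rewrite ?mulr1 ?mulr0.
under eq_integral do rewrite EFinM.
rewrite ge0_integralZl_EFin ?exprn_ge0 ?mulr_ge0 ?ltW //; last first.
  by apply/measurable_EFinP; apply: measurable_indic; exact: measurable_ball.
rewrite integral_indic // ?setIT; last exact: measurable_ball.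
have bE := @lebesgue_measure_ball R (p ord0 ord0) s (ltW s0).
by rewrite [X in (_ * X)%E]bE -EFinM exprSr -[s *+ 2]mulr_natl.
Qed.
End lebesgue_cube.

Section lipschitz.
Context {R : realType} {n : nat}.
Local Notation Rn := 'rV[R]_n.+1.

Lemma enorm_orthogonal (Q : 'M[R]_n.+1) (x : Rn) : Q *m Q^T = 1%:M ->
  enorm (x *m Q) = enorm x.
Proof.
move=> QQ; have dotE (v : Rn) : dotp v v = (v *m v^T) ord0 ord0.
  by rewrite mxE; apply: eq_bigr => i _; rewrite !mxE.
apply/eqP; rewrite -(@eqrXn2 _ 2) ?enorm_ge0 // !enorm_sqr !dotE.
by rewrite trmx_mul mulmxA -(mulmxA x) QQ mulmx1.
Qed.

Lemma enorm_col' (x : Rn) : enorm (col' ord_max x) <= enorm x.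
Proof.
rewrite -ler_sqr ?nnegrE ?enorm_ge0 // !enorm_sqr /dotp.
rewrite [leRHS]big_ord_recr /= -expr2 -[leLHS]addr0 lerD ?sqr_ge0 //.
rewrite le_eqVlt; apply/orP; left; apply/eqP; apply: eq_bigr => i _.
rewrite !mxE; congr (x _ _ * x _ _); apply: val_inj => /=; exact: lift_max.
Qed.

(** The set of parameters t in [0, 1] for which z + t (w - z) lies in S is
    nonempty, open and closed, since the segment avoids the frontier. *)
Lemma eball_sub_of_no_frontier (S : set Rn) (z : Rn) (rho : R) :
  S z -> (forall y, eball z rho y -> ~ frontier S y) -> eball z rho `<=` S.
Proof.
move=> Sz nofr w zw.
pose p (t : R) : Rn := z + t *: (w - z).
have cp : continuous p.
  by move=> t; apply: cvgD; [exact: cvg_cst|apply: cvgZl; exact: cvg_id].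
have p_in t : t \in `[0, 1] -> eball z rho (p t).
  rewrite in_itv /= /eball /p /= => /andP[t0 t1].
  rewrite addrAC subrr add0r enormZ ger0_norm //.
  by apply: le_lt_trans zw; rewrite ler_piMl ?enorm_ge0.
have p0 : p 0 = z by rewrite /p scale0r addr0.
have p1 : p 1 = w by rewrite /p scale1r addrC subrK.
have SE t : t \in `[0, 1] -> S (p t) -> S° (p t).
  move=> /p_in/nofr nf Spt; apply: contrapT => nI; apply: nf; split => //.
  exact: subset_closure.
have clE t : t \in `[0, 1] -> closure S (p t) -> S (p t).
  move=> /p_in/nofr nf Spt; apply: interior_subset; apply: contrapT => nI.
  exact: nf.
have conn := @segment_connected R 0 1.
have : [set t | t \in `[0, 1] /\ S (p t)] = `[0, 1]%classic.
  apply: conn.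
  - by exists 0; rewrite /= p0 in_itv /= lexx ler01.
  - exists (p @^-1` S°).
      by apply: open_comp; [move=> t _; exact: cp|exact: open_interior].
    apply/seteqP; split => t [t01 h]; split => //; first exact: SE.
    exact: (interior_subset h).
  - exists (p @^-1` closure S).
      by apply: closed_comp; [move=> t _; exact: cp|exact: closed_closure].
    apply/seteqP; split => t [t01 h]; split => //; last exact: clE.
    exact: subset_closure.
move=> /seteqP[_ /(_ 1)] /=; rewrite p1 in_itv /= lexx ler01 => /(_ isT) [].
by [].
Qed.

Lemma eball_center (z : Rn) (rho : R) : 0 < rho -> eball z rho z.
Proof. by rewrite /eball /= subrr enorm0. Qed.

(** If z is at distance at least rho from the frontier, the whole ball around z
    lies in S. Otherwise a chart is available around z, and there the upward
    cone of slope L with apex z stays above the graph. This cone contains a ball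
    centred at height rho / 2 above z, of radius s with s (1 + L) = rho / 2.
    Producing a ball rather than the cone spares the computation of the volume
    of a rotated set: a ball is invariant under the rotation of the chart, and
    it contains a cube parallel to the original axes. *)
Lemma lipschitz_boundary_ball (L r rho : R) (S : set Rn) (z : Rn) :
  0 <= L -> 0 < rho -> 2 * rho <= r -> lipschitz_boundary L r S -> S z ->
  exists p : Rn, eball p (rho / (2 * (1 + L))) `<=` S `&` eball z rho.
Proof.
move=> L0 rho0 rho_r lipS Sz.
set s := rho / (2 * (1 + L)).
have L1 : 0 < 2 * (1 + L) by rewrite mulr_gt0 // ltr_pwDl.
have s0 : 0 < s by rewrite divr_gt0.
have sL : s * (1 + L) = rho / 2 by rewrite /s; field; rewrite gt_eqF // ltr_pwDl.
have s_le : s <= rho / 2 by rewrite -sL ler_peMr ?(ltW s0) // lerDl.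
have [[x0 [zx0 frx0]]|nofr] :=
  pselect (exists x0, eball z rho x0 /\ frontier S x0); last first.
  exists z => y zy; have zy' : eball z rho y.
    by rewrite /eball /= (lt_le_trans zy) // (le_trans s_le) //; lra.
  split => //; apply: (@eball_sub_of_no_frontier S z rho) => // w zw frw.
  by apply: nofr; exists w.
have [Q [b [gamma [QQ gammaL chart]]]] := lipS _ frx0.
(* The vertical vector of length rho / 2, in the coordinates of the chart. *)
pose e : Rn := (rho / 2) *: delta_mx ord0 ord_max.
have e_norm : enorm e = rho / 2.
  rewrite enormZ ger0_norm ?divr_ge0 ?ltW // -[RHS]mulr1; congr (_ * _).
  apply/eqP; rewrite -(@eqrXn2 _ 2) ?enorm_ge0 // enorm_sqr /dotp big_ord_recr /=.
  rewrite big1 => [|i _]; last first.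
    rewrite !mxE (_ : widen_ord _ i == ord_max = false) ?andbF ?mulr0 //.
    by rewrite -val_eqE /= ltn_eqF.
  by rewrite !mxE !eqxx /= mulr1 add0r expr1n.
have QtQ : Q^T *m Q = 1%:M by exact: mulmx1C.
exists (z + e *m Q^T) => y py.
set v : Rn := (y - (z + e *m Q^T)) *m Q.
have v_s : enorm v < s by rewrite enorm_orthogonal.
have yE : y - z = (e + v) *m Q^T.
  rewrite mulmxDl /v -mulmxA QQ mulmx1.
  by rewrite [RHS]addrC opprD addrA subrK.
have zy : eball z rho y.
  rewrite /eball /= yE (@enorm_orthogonal Q^T) ?trmxK //.
  by apply: (le_lt_trans (ler_enormD _ _)); rewrite e_norm; lra.
split => //.
have in_chart w : eball z rho w -> eball x0 r w.
  rewrite /eball /= => zw.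
  have -> : w - x0 = (w - z) + (z - x0) by rewrite addrA subrK.
  apply: (le_lt_trans (ler_enormD _ _)); rewrite (enormB z).
  by move: zx0; rewrite /eball /=; lra.
have [[/(_ Sz) above_z _] _] := chart z (in_chart z (eball_center z rho0)).
have [[_ in_y] _] := chart y (in_chart y zy).
apply: in_y.
have -> : y *m Q + b = (z *m Q + b) + (e + v).
  by rewrite -[in LHS](subrK z y) yE mulmxDl -mulmxA QtQ mulmx1 -[LHS]addrA [LHS]addrC.
set w := z *m Q + b in above_z *.
have -> : col' ord_max (w + (e + v)) = col' ord_max w + col' ord_max v.
  apply/rowP => i; rewrite !mxE [lift _ _ == _]eq_sym (negbTE (neq_lift _ _)).
  by rewrite andbF mulr0 add0r.
have := gammaL (col' ord_max w + col' ord_max v) (col' ord_max w).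
rewrite addrAC subrr add0r => /ler_normlP[_].
have := ler_wpM2l L0 (enorm_col' v).
have := ler_norm (- v ord0 ord_max); rewrite normrN.
have := enorm_coord v ord_max.
have := ler_wpM2l L0 (ltW v_s).
have -> : (w + (e + v)) ord0 ord_max = w ord0 ord_max + (rho / 2 + v ord0 ord_max).
  by rewrite !mxE !eqxx mulr1.
by move: sL above_z v_s; rewrite mulrDr mulr1 [s * L]mulrC; lra.
Qed.
End lipschitz.

(** * The unregularized plan *)

Section ot_self.
Context {R : realType} {n : nat}.
Local Notation Rn := 'rV[R]_n.

Definition diag_map (x : Rn) : Rn * Rn := (x, x).

Lemma measurable_diag_map : measurable_fun setT diag_map.
Proof. by apply: measurable_fun_pair; exact: measurable_id. Qed.

HB.instance Definition _ :=
  isMeasurableFun.Build _ _ _ _ diag_map measurable_diag_map.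

Lemma enorm_eq0 (v : Rn) : enorm v = 0 -> v = 0.
Proof.
move=> v0; apply/rowP => i; rewrite mxE.
by apply/eqP; rewrite -normr_le0 -v0 enorm_coord.
Qed.

Lemma qcost_ge0 (x y : Rn) : 0 <= qcost x y.
Proof. by rewrite mulr_ge0 ?sqr_ge0. Qed.

(** The diagonal coupling has cost zero, so an optimal coupling also has cost
    zero and charges no set on which x differs from y. A product V x R^n
    around a diagonal point then has the same mass as its part in V x V. *)
Lemma diagonal_in_spt_ot_plan (mu : probability Rn R)
    (P : probability (Rn * Rn)%type R) x :
  ot_plan mu mu P -> spt mu x -> spt P (x, x).
Proof.
move=> [[marg1 _] opt] Sx U oU Uxx.
have mcost : measurable_fun setT (fun z : Rn * Rn => qcost z.1 z.2).
  exact: (continuous_measurable_prod (@continuous_qcost R n)).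
have cost0 : (ot_cost P <= 0)%E.
  have := opt (distribution mu diag_map).
  suff -> : ot_cost (distribution mu diag_map) = 0%E.
    by apply; split => B mB; rewrite /= /distribution /pushforward;
      congr (mu _); apply/seteqP; split => y //; case.
  rewrite /ot_cost ge0_integral_distribution //=.
  - apply: integral0_eq => y _ /=.
    by rewrite /qcost subrr enorm0 expr0n mulr0.
  - exact/measurable_EFinP.
  - by move=> z; rewrite lee_fin qcost_ge0.
pose A : set (Rn * Rn) := [set z | 0 < qcost z.1 z.2].
have mA : measurable A.
  apply: open_measurable_prod.
  apply: (@open_comp _ _ (fun z => qcost z.1 z.2) [set t | 0 < t]) => [z _|].
    exact: continuous_qcost.
  exact: open_gt.
have A0 : P A = 0%E.
  apply: (@integral_eq_null_lt _ _ _ P setT measurableT (cst 0)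
    (fun z => qcost z.1 z.2)) => //.
  - by move=> z _; rewrite lexx qcost_ge0.
  - by rewrite integral0 ltry.
  - by rewrite integral0.
have [p [p1 p2 pU]] := open_prod_basis oU Uxx.
pose V := rat_ball p.1 `&` rat_ball p.2 : set Rn.
have oV : open V by apply: openI; exact: rat_ball_open.
have mV := open_measurable_rV oV.
have mU := open_measurable_prod oU.
have VUA : V `*` setT `<=` U `|` A.
  move=> [y y'] [/= [y1 y2] _].
  have [->|yy] := eqVneq y' y; first by left; apply: pU.
  right; rewrite /A /= /qcost mulr_gt0 ?invr_gt0 // exprn_gt0 //.
  rewrite lt_neqAle enorm_ge0 andbT.
  by apply: contra_neq yy => /esym/enorm_eq0 /eqP; rewrite subr_eq0 => /eqP.
have muV : (0 < mu V)%E by apply: Sx.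
have : (P (V `*` setT) <= P (U `|` A))%E.
  by apply: le_measure => //; rewrite inE; [exact: measurableX|exact: measurableU].
rewrite marg1 // => /(lt_le_trans muV) h; apply: (lt_le_trans h).
have subadd : (P (U `|` A) <= P U + P A)%E by exact: measureU2.
by move: subadd; rewrite A0 adde0.
Qed.
End ot_self.

(** * Displacement of the regularized plan *)

Section bound.
Context {R : realType} {n : nat}.
Local Notation Rn := 'rV[R]_n.+1.

Lemma mass_near_support_point (c L r rho : R) (mu : probability Rn R) (z : Rn) :
  0 <= L -> 0 < rho -> 2 * rho <= r ->
  density_ge c mu -> lipschitz_boundary L r (spt mu) -> spt mu z ->
  exists A : set Rn, [/\ measurable A, A `<=` spt mu `&` eball z rho
    & ((c * (rho / ((1 + L) * n.+1%:R)) ^+ n.+1)%:E <= mu A)%E].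
Proof.
move=> L0 rho0 rho_r dens lip Sz.
have [p psub] := lipschitz_boundary_ball L0 rho0 rho_r lip Sz.
set s := rho / (2 * (1 + L)) in psub.
have n0 : (0 : R) < n.+1%:R by rewrite ltr0n.
have L1 : 0 < 1 + L by rewrite ltr_pwDl.
have s0 : 0 < s by rewrite divr_gt0 // mulr_gt0.
have t0 : 0 < s / n.+1%:R by rewrite divr_gt0.
have Asub : ball p (s / n.+1%:R) `<=` spt mu `&` eball z rho.
  move=> y /ball_rVP - /(_ t0) py; apply: psub.
  by rewrite /eball /= enormB; apply: enorm_lt_coord => i; rewrite !mxE.
have mA : measurable (ball p (s / n.+1%:R)).
  by apply: open_measurable_rV; exact: ball_open.
exists (ball p (s / n.+1%:R)); split => //.
have := dens _ mA; rewrite setIidl; last by move=> y /Asub[].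
rewrite lebesgue_rV_cube // -EFinM.
by congr (((_ * _ ^+ _)%:E <= _)%E); rewrite /s; field; rewrite !gt_eqF.
Qed.

(** Let delta be the supremum of the displacements. Symmetry gives a point
    z whose diagonal gap is of order delta^2, and the almost-Lipschitz bound
    keeps the gap of that order on the points of the support at distance at
    most theta delta from z. The integral of the positive part, equal to eps, is
    then at least a constant times delta^2 times the mass of these points, which
    is at least of order delta^(n+1). The bound on theta by 1/16 makes the gap
    survive; as delta <= 2, the bound by r/4 keeps twice the radius theta delta
    below the radius r of the charts. *)
Lemma support_displacement (c L r theta eps : R) (mu : probability Rn R)
    (f g : Rn -> R) (x0 y0 : Rn) :
  0 < c -> 0 <= L -> 0 < theta -> theta <= 16^-1 -> 4 * theta <= r ->
  standing_assumptions mu -> density_ge c mu ->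
  lipschitz_boundary L r (spt mu) ->
  0 < eps -> qot_potentials eps mu mu f g ->
  spt mu x0 -> spt mu y0 -> 0 < qot_gap f g x0 y0 ->
  c / 32 * (theta / ((1 + L) * n.+1%:R)) ^+ n.+1 *
    enorm (x0 - y0) ^+ (n.+1 + 2) <= eps.
Proof.
move=> c0 L0 th0 th1 thr [_ Sball _] dens lip eps0 pot Sx Sy gap0.
have [cf cg eqx eqy] := pot.
pose D : set R := [set t | exists x y,
  [/\ spt mu x, spt mu y, 0 < qot_gap f g x y & t = enorm (x - y)]].
have D2 : ubound D 2.
  move=> _ [x [y [/Sball + /Sball + _ ->]]]; rewrite /eball /= !subr0 => x1 y1.
  by have := ler_enormD x (- y); rewrite enormN; lra.
have D_in : D (enorm (x0 - y0)) by exists x0, y0.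
have supD : has_sup D by split; [exists (enorm (x0 - y0))|exists 2].
pose delta := sup D.
have delta_ub x y : spt mu x -> spt mu y -> 0 < qot_gap f g x y ->
    enorm (x - y) <= delta.
  by move=> ? ? ?; apply: sup_upper_bound => //; exists x, y.
have delta2 : delta <= 2 by apply: ge_sup => //; exists (enorm (x0 - y0)).
have L1 : 0 < 1 + L by rewrite ltr_pwDl.
have n0 : (0 : R) < n.+1%:R by rewrite ltr0n.
have k0 : 0 < (1 + L) * n.+1%:R by rewrite mulr_gt0.
have delta_ge0 : 0 <= delta.
  by apply: le_trans (enorm_ge0 (x0 - y0)) _; exact: delta_ub.
apply: (@le_trans _ _
  (c / 32 * (theta / ((1 + L) * n.+1%:R)) ^+ n.+1 * delta ^+ (n.+1 + 2))).
  rewrite ler_pM2l ?mulr_gt0 ?exprn_gt0 ?divr_gt0 //.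
  by apply: lerXn2r; rewrite ?nnegrE ?enorm_ge0 ?delta_ub.
have [delta_le0|delta0] := lerP delta 0.
  have -> : delta = 0 by apply/eqP; rewrite eq_le delta_le0.
  by rewrite addn2 expr0n /= mulr0 ltW.
have [_ [x [y [Sx1 Sy1 gap1 ->]]] far] : exists2 t, D t & delta - delta / 2 < t.
  by apply: sup_adherent => //; rewrite divr_gt0.
have gap2 := support_symmetric pot Sx1 Sy1 gap1.
have far2 : (delta / 2) ^+ 2 <= enorm (x - y) ^+ 2.
  by apply: lerXn2r; rewrite ?nnegrE ?enorm_ge0 //; lra.
(* The diagonal gaps at x and y add up to more than |x - y|^2. *)
have [z [Sz gapz]] : exists z, spt mu z /\ delta ^+ 2 / 8 <= qot_gap f g z z.
  have := qot_gap_diag f g x y.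
  have [?|] := lerP (delta ^+ 2 / 8) (qot_gap f g x x); first by exists x.
  by exists y; split => //; lra.
have rho0 : 0 < theta * delta by rewrite mulr_gt0.
have rho_r : 2 * (theta * delta) <= r.
  by have := ler_wpM2l (ltW th0) delta2; lra.
have [A [mA Asub muA]] := mass_near_support_point L0 rho0 rho_r dens lip Sz.
have gapA w : A w -> delta ^+ 2 / 32 <= qot_gap f g z w.
  move=> /Asub[Sw zw]; have := potential_almost_lipschitz eps0 cf cg eqx delta_ub z Sw.
  have zw' : enorm (z - w) <= delta / 16.
    rewrite enormB; apply: le_trans (ltW zw) _.
    by have := ler_wpM2r (ltW delta0) th1; lra.
  have zw2 : enorm (z - w) ^+ 2 <= (delta / 16) ^+ 2.
    by apply: lerXn2r; rewrite ?nnegrE ?enorm_ge0 // divr_ge0 ?ltW.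
  have := ler_wpM2l (ltW delta0) zw'.
  move: gapz; rewrite /qot_gap {1}/qcost subrr enorm0 expr0n /= mulr0 /qcost.
  have : (delta / 16) ^+ 2 = delta ^+ 2 / 256 by field.
  have : delta * (delta / 16) = delta ^+ 2 / 16 by field.
  have := sqr_ge0 delta.
  lra.
rewrite -lee_fin -(eqy z).
have mgapz : measurable_fun setT (fun w => Num.max (qot_gap f g z w) 0).
  exact: (measurableT_comp (measurable_gap_pos cf cg) (pair1_measurable z)).
apply: (@le_trans _ _ (\int[mu]_(w in A) (delta ^+ 2 / 32)%:E)%E); last first.
  apply: (@le_trans _ _ (\int[mu]_(w in A) (Num.max (qot_gap f g z w) 0)%:E)%E).
    apply: ge0_le_integral => //.
    - by move=> w _; rewrite lee_fin divr_ge0 ?sqr_ge0.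
    - by apply/measurable_EFinP; exact: (measurable_funTS mgapz).
    - by move=> w Aw; rewrite lee_fin le_max gapA.
  apply: ge0_subset_integral => //.
  - exact/measurable_EFinP.
  - by move=> w _; rewrite lee_fin le_max lexx orbT.
rewrite integral_cst //.
have d32 : (0 <= (delta ^+ 2 / 32)%:E)%E by rewrite lee_fin divr_ge0 ?sqr_ge0.
apply: le_trans (lee_wpmul2l d32 muA).
rewrite -EFinM lee_fin le_eqVlt; apply/orP; left; apply/eqP.
by rewrite addn2 !expr_div_n !exprMn !exprS; field; rewrite ?gt_eqF ?exprn_gt0.
Qed.
End bound.

(** * The distance between the supports *)

(** As max(1, K^-1) is at least 1, its m-th power is still at least K^-1; this
    constant avoids an m-th root of K. *)
Lemma le_powR_root (R : realType) (m : nat) (K eps t : R) :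
  (0 < m)%N -> 0 < K -> 0 < eps -> 0 <= t -> K * t ^+ m <= eps ->
  t <= Num.max 1 K^-1 * eps `^ m%:R^-1.
Proof.
move=> m0 K0 eps0 t0 Kt; set C := Num.max 1 K^-1.
have C1 : 1 <= C by rewrite le_max lexx.
have C0 : 0 <= C by apply: le_trans C1.
have root_m : (eps `^ m%:R^-1) ^+ m = eps.
  rewrite -powR_mulrn ?powR_ge0 // -powRrM mulVf ?pnatr_eq0 -?lt0n //.
  by rewrite powRr1 // ltW.
rewrite -(ler_pXn2r m0) ?nnegrE ?mulr_ge0 ?powR_ge0 // exprMn root_m.
apply: (@le_trans _ _ (K^-1 * eps)); first by rewrite ler_pdivlMl.
rewrite ler_pM2r // (@le_trans _ _ C) //; first by rewrite le_max lexx orbT.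
by rewrite -[leLHS]expr1 ler_weXn2l.
Qed.

(** The three conclusions are closed conditions, so they pass from the pairs
    with positive gap to the closure of the set of these pairs. *)
Lemma spt_qot_displacement (R : realType) n (mu : probability 'rV[R]_n R)
    (f g : 'rV[R]_n -> R) (b : R) :
  (forall x y, spt mu x -> spt mu y -> 0 < qot_gap f g x y ->
    enorm (x - y) <= b) ->
  forall z, spt_qot mu mu f g z ->
    [/\ spt mu z.1, spt mu z.2 & enorm (z.1 - z.2) <= b].
Proof.
move=> hb z.
pose F : set ('rV[R]_n * 'rV[R]_n) := fst @^-1` spt mu `&` (snd @^-1` spt mu `&`
  (fun z => enorm (z.1 - z.2)) @^-1` [set t | t <= b]).
have cF : closed F.
  apply: closedI.
    by apply: preimage_closed (@spt_closed _ _ _) => y _; exact: cvg_fst.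
  apply: closedI.
    by apply: preimage_closed (@spt_closed _ _ _) => y _; exact: cvg_snd.
  by apply: preimage_closed (@closed_le _ _) => y _; exact: continuous_enorm_sub.
suff sub : spt_qot mu mu f g `<=` F by move=> /sub[? []].
rewrite [F](closure_id F).1 //.
apply: closure_subset => y [/spt_product_coords[y1 y2] gap].
by split => //; split => //; exact: hb.
Qed.

Theorem corollary3p3 (R : realType) (n : nat) (c L r : R) :
  0 < c -> 0 <= L -> 0 < r ->
  exists C : R, 0 < C /\
    forall (mu : probability 'rV[R]_n.+1 R),
      standing_assumptions mu ->
      density_ge c mu ->
      lipschitz_boundary L r (spt mu) ->
      forall (pi_star : probability ('rV[R]_n.+1 * 'rV[R]_n.+1)%type R),
        ot_plan mu mu pi_star ->
      forall (eps : R) (pi_eps : probability ('rV[R]_n.+1 * 'rV[R]_n.+1)%type R)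
             (f g : 'rV[R]_n.+1 -> R),
        0 < eps ->
        qot_solution eps mu mu pi_eps f g ->
        (asym_dist (spt_qot mu mu f g) (spt pi_star) <=
         C%:E * mine (eps `^ ((n.+1 + 2)%:R^-1))%:E (diam (spt mu)))%E.
Proof.
move=> c0 L0 r0.
pose theta : R := Num.min 16^-1 (r / 4).
have th0 : 0 < theta by rewrite lt_min invr_gt0 ltr0n divr_gt0.
have th16 : theta <= 16^-1 by rewrite ge_min lexx.
have thr : 4 * theta <= r.
  by have : theta <= r / 4 by [rewrite ge_min lexx orbT]; lra.
pose K : R := c / 32 * (theta / ((1 + L) * n.+1%:R)) ^+ n.+1.
have K0 : 0 < K.
  rewrite mulr_gt0 ?divr_gt0 // exprn_gt0 // divr_gt0 //.
  by rewrite mulr_gt0 ?ltr0n // ltr_pwDl.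
pose C := Num.max 1 K^-1.
have C1 : 1 <= C by rewrite le_max lexx.
have C0 : 0 < C by apply: lt_le_trans C1.
exists C; split => // mu std dens lip pi_star opt eps pi_eps f g eps0 [_ pot _].
have disp : forall z, spt_qot mu mu f g z -> [/\ spt mu z.1, spt mu z.2 &
    enorm (z.1 - z.2) <= C * eps `^ ((n.+1 + 2)%:R^-1)].
  apply: spt_qot_displacement => x y Sx Sy gap0.
  apply: le_powR_root => //; first exact: enorm_ge0.
  exact: (support_displacement c0 L0 th0 th16 thr std dens lip eps0 pot).
apply: ge_ereal_sup => _ [z /disp[S1 S2 z_le] <-].
apply: (@le_trans _ _ (enorm (z.1 - z.2))%:E).
  apply: ereal_inf_lbound; exists (z.1, z.1).
    exact: diagonal_in_spt_ot_plan opt S1.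
  rewrite /enorm2 /= subrr enorm0 expr0n add0r sqrtr_sqr ger0_norm ?enorm_ge0 //.
  by rewrite enormB.
have [_|_] := leP (eps `^ ((n.+1 + 2)%:R^-1))%:E (diam (spt mu)).
  by rewrite -EFinM lee_fin.
have diam_ge : ((enorm (z.1 - z.2))%:E <= diam (spt mu))%E.
  by apply: ereal_sup_ubound; exists z.
apply: (le_trans diam_ge); apply: lee_pemull; last by rewrite lee_fin.
by apply: le_trans diam_ge; rewrite lee_fin enorm_ge0.
Qed.
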